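(* Let $f,b:\mathcal{S}\to\mathbb{R}$ be Hölder continuous functions with exponents $\eta_1,\eta_2$ respectively, with $b(q_i)=f(q_i)$ for $i=1,2,3$, and suppose that the interpolation points $$(q_1,f(q_1)),\ (q_2,f(q_2)),\ (q_3,f(q_3)),\ (q_{12},f(q_{12})),\ (q_{13},f(q_{13})),\ (q_{23},f(q_{23}))$$ in $\mathbb{R}^3$ are not coplanar. Let $\alpha_1,\alpha_2,\alpha_3\in(-1,1)$, let $f^\alpha$ be the $\alpha$-fractal function corresponding to $f$ (with base function $b$), and let $G=\{(\mathbf{x},f^\alpha(\mathbf{x})):\mathbf{x}\in\mathcal{S}\}$ be its graph. Let $\psi=\sum_{i=1}^3|\alpha_i|$ and $\eta=\min\{\eta_1,\eta_2\}$. Then the box dimension of $G$ has the following bounds: (I) If $\frac{\psi2^\eta}{3}\le1$, then $\frac{\log3}{\log2}\le\underline{\dim}_B(G)\le\overline{\dim}_B(G)\le1-\eta+\frac{\log3}{\log2}$. (II) If $\frac{\psi2^\eta}{3}>1$, then $\frac{\log3}{\log2}\le\underline{\dim}_B(G)\le\overline{\dim}_B(G)\le1+\frac{\log\psi}{\log2}$.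
   Context: Let $q_1=(0,0)$, $q_2=(1,0)$, $q_3=(\frac12,\frac{\sqrt3}{2})$, $L_i(\mathbf{x})=\frac12(\mathbf{x}-q_i)+q_i$ for $i=1,2,3$, and let $\mathcal{S}\subset\mathbb{R}^2$ be the Sierpiński gasket, i.e. the unique nonempty compact set with $\mathcal{S}=\bigcup_{i=1}^3L_i(\mathcal{S})$. Write $q_{ij}=L_i(q_j)$. A function $g:\mathcal{S}\to\mathbb{R}$ is Hölder continuous with exponent $\eta>0$ if there is $C\ge0$ with $|g(\mathbf{x})-g(\mathbf{y})|\le C\|\mathbf{x}-\mathbf{y}\|^\eta$ for all $\mathbf{x},\mathbf{y}\in\mathcal{S}$. $\alpha$-fractal function: for $i=1,2,3$ define on $\mathcal{S}\times\mathbb{R}$ the maps $F_i(\mathbf{x},y)=\alpha_iy+f(L_i(\mathbf{x}))-\alpha_ib(\mathbf{x})$ and $\mathbf{f}_i(\mathbf{x},y)=(L_i(\mathbf{x}),F_i(\mathbf{x},y))$. The attractor (nonempty compact invariant set) of the iterated function system $\{\mathbf{f}_1,\mathbf{f}_2,\mathbf{f}_3\}$ is the graph of a continuous function $f^\alpha:\mathcal{S}\to\mathbb{R}$, the $\alpha$-fractal function; it satisfies $f^\alpha(\mathbf{x})=f(\mathbf{x})+\alpha_i(f^\alpha-b)(L_i^{-1}(\mathbf{x}))$ for $\mathbf{x}\in L_i(\mathcal{S})$. Box dimension: for a nonempty bounded $F\subset\mathbb{R}^3$, let $N_\delta(F)$ be the least number of sets of diameter at most $\delta$ covering $F$; $\underline{\dim}_B(F)$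 and $\overline{\dim}_B(F)$ are the $\liminf$ and $\limsup$ of $\frac{\log N_\delta(F)}{-\log\delta}$ as $\delta\to0^+$. *)

(* Defs.v *)
From HB Require Import structures.
From mathcomp Require Import all_boot all_order all_algebra.
From mathcomp Require Import all_classical all_reals all_analysis.

Set Implicit Arguments.
Unset Strict Implicit.
Unset Printing Implicit Defensive.

Import Order.TTheory GRing.Theory Num.Theory.
Import numFieldNormedType.Exports.

Local Open Scope classical_set_scope.
Local Open Scope ring_scope.

(* The library norm on 'rV[R]_n is the sup norm, so the Euclidean one is
   defined here. Both induce the same topology; [compact] and [continuous]
   below are the library's. *)
Definition enorm (R : realType) (n : nat) (x : 'rV[R]_n) : R :=
  Num.sqrt (\sum_(i < n) x 0 i ^+ 2).

Definition diam (R : realType) (n : nat) (U : set 'rV[R]_n) : \bar R :=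
  ereal_sup [set (enorm (x - y))%:E | x in U & y in U].

(* Equal to +oo when no finite cover exists, as for unbounded F. *)
Definition covering_number (R : realType) (n : nat) (F : set 'rV[R]_n)
    (delta : R) : \bar R :=
  ereal_inf [set (N%:R)%:E | N in [set N : nat |
    exists U : 'I_N -> set 'rV[R]_n,
      F `<=` \bigcup_i U i /\ forall i, (diam (U i) <= delta%:E)%E]].

Definition box_ratio (R : realType) (n : nat) (F : set 'rV[R]_n)
    (delta : R) : \bar R :=
  (lne (covering_number F delta) * ((- ln delta)^-1)%:E)%E.

Definition lower_box_dim (R : realType) (n : nat) (F : set 'rV[R]_n) : \bar R :=
  limf_einf (box_ratio F) (0 : R)^'+.

Definition upper_box_dim (R : realType) (n : nat) (F : set 'rV[R]_n) : \bar R :=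
  limf_esup (box_ratio F) (0 : R)^'+.

(* For the systems considered here such a set is unique. *)
Definition is_attractor (T : topologicalType) (I : Type) (w : I -> T -> T)
    (A : set T) : Prop :=
  [/\ A !=set0, compact A & A = \bigcup_i (w i @` A)].

Definition point2 (R : realType) (a b : R) : 'rV[R]_2 :=
  \row_(j < 2) (if j == 0 then a else b).

(* The types 'rV_(2 + 1) and 'rV_3 are convertible. *)
Definition point3 (R : realType) (x : 'rV[R]_2) (y : R) : 'rV[R]_3 :=
  row_mx x (y%:M : 'M[R]_1) : 'rV[R]_(2 + 1).

Definition base_part (R : realType) (p : 'rV[R]_3) : 'rV[R]_2 :=
  lsubmx (p : 'rV[R]_(2 + 1)).

Definition height (R : realType) (p : 'rV[R]_3) : R := p 0 ord_max.

(* The indices 1, 2, 3 are shifted to 0, 1, 2. *)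
Definition i1 : 'I_3 := @Ordinal 3 0 isT.
Definition i2 : 'I_3 := @Ordinal 3 1 isT.
Definition i3 : 'I_3 := @Ordinal 3 2 isT.

Definition vertex (R : realType) (i : 'I_3) : 'rV[R]_2 :=
  nth 0 [:: point2 0 0; point2 1 0; point2 2^-1 (Num.sqrt 3 / 2)] i.
Arguments vertex R i : clear implicits.

Definition L (R : realType) (i : 'I_3) (x : 'rV[R]_2) : 'rV[R]_2 :=
  2^-1 *: (x - vertex R i) + vertex R i.

Definition midpoint (R : realType) (i j : 'I_3) : 'rV[R]_2 := L i (vertex R j).
Arguments midpoint R i j : clear implicits.

Definition is_sierpinski_gasket (R : realType) (S : set 'rV[R]_2) : Prop :=
  is_attractor (@L R) S.

(* Functions on S are total functions of which only the values on S matter. *)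
Definition holder_on (R : realType) (S : set 'rV[R]_2) (eta : R)
    (g : 'rV[R]_2 -> R) : Prop :=
  exists2 C : R, 0 <= C &
    forall x y, S x -> S y -> `|g x - g y| <= C * enorm (x - y) `^ eta.

Definition coplanar (R : realType) (P : set 'rV[R]_3) : Prop :=
  exists (u : 'rV[R]_3) (c : R),
    u != 0 /\ forall p, P p -> \sum_(k < 3) u 0 k * p 0 k = c.

Definition interpolation_points (R : realType) (f : 'rV[R]_2 -> R) :
    set 'rV[R]_3 :=
  [set point3 x (f x) | x in
    [set` [:: vertex R i1; vertex R i2; vertex R i3;
              midpoint R i1 i2; midpoint R i1 i3; midpoint R i2 i3]]].

Definition graph_on (R : realType) (S : set 'rV[R]_2) (g : 'rV[R]_2 -> R) :
    set 'rV[R]_3 :=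
  [set point3 x (g x) | x in S].

Definition fractal_height (R : realType) (f b : 'rV[R]_2 -> R)
    (alpha : 'I_3 -> R) (i : 'I_3) (x : 'rV[R]_2) (y : R) : R :=
  alpha i * y + f (L i x) - alpha i * b x.

Definition fractal_map (R : realType) (f b : 'rV[R]_2 -> R)
    (alpha : 'I_3 -> R) (i : 'I_3) (p : 'rV[R]_3) : 'rV[R]_3 :=
  point3 (L i (base_part p)) (fractal_height f b alpha i (base_part p) (height p)).

Definition is_alpha_fractal_function (R : realType) (S : set 'rV[R]_2)
    (f b : 'rV[R]_2 -> R) (alpha : 'I_3 -> R) (fa : 'rV[R]_2 -> R) : Prop :=
  {within S, continuous fa} /\
  is_attractor (fractal_map f b alpha) (graph_on S fa).

(* Main.v *)
(** The map [L_w], for a word [w] of length [n], contracts the gasket by [2^-n].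

    Lower bound: the points [L_w x], [w] of length [n], are [3^n] points of a
    translated triangular lattice of mesh [2^-n], so the points of the graph above
    them lie in distinct sets of any cover by sets of diameter less than [2^-n].

    Upper bound: by the functional equation the oscillation [o_w] of the fractal
    function on the cell [L_w S] satisfies [o_(iw) <= |alpha_i| o_w + K 2^(-n eta)],
    so [O_n], the sum of [o_w] over the words of length [n], satisfies
    [O_(n+1) <= psi O_n + 3 K (3 * 2^-eta)^n].  Hence [O_n <= A s^n] for every
    [s > max psi (3 * 2^-eta)], and cutting each cell into slabs of height [2^-n]
    covers the graph by at most [2 * 2^n O_n + 3^n] sets of diameter [O(2^-n)].
    The term [3^n] is dominated by [(2 s)^n] because [eta <= 1]: for [eta1 > 1],
    [f] would be constant on the six interpolation points, making them coplanar. *)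

Require Import Defs.
From mathcomp Require Import all_boot all_order all_algebra.
From mathcomp Require Import all_classical all_reals all_analysis.
From mathcomp Require Import ring lra.

Import Order.TTheory GRing.Theory Num.Theory.
Import numFieldNormedType.Exports.

Local Open Scope classical_set_scope.
Local Open Scope ring_scope.

Set Implicit Arguments.
Unset Strict Implicit.

(** * Box dimension *)

Lemma limf_esup_le_near (R : realType) (T : choiceType) (X : filteredType T)
    (h : X -> \bar R) (F : set (set X)) (V : set X) (c : \bar R) :
  F V -> (forall x, V x -> (h x <= c)%E) -> (limf_esup h F <= c)%E.
Proof.
move=> FV hV; rewrite limf_esupE.
apply: (@le_trans _ _ (ereal_sup (h @` V))).
  by apply: ereal_inf_lbound; exists V.
by apply: ge_ereal_sup => _ [x Vx <-]; exact: hV.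
Qed.

Lemma limf_einf_ge_near (R : realType) (T : choiceType) (X : filteredType T)
    (h : X -> \bar R) (F : set (set X)) (V : set X) (c : \bar R) :
  F V -> (forall x, V x -> (c <= h x)%E) -> (c <= limf_einf h F)%E.
Proof.
move=> FV hV; rewrite leeNr; apply: (@limf_esup_le_near _ _ _ _ _ V) => // x Vx.
by rewrite leeN2; exact: hV.
Qed.

(** Two sets of a proper filter share a point, whose value lies above the infimum over one and below
    the supremum over the other. *)
Lemma limf_einf_le_esup (R : realType) (T : choiceType) (X : filteredType T)
    (h : X -> \bar R) (F : set_system X) :
  ProperFilter F -> (limf_einf h F <= limf_esup h F)%E.
Proof.
move=> PF; rewrite limf_einfE limf_esupE.
apply: ge_ereal_sup => _ [V FV <-]; apply: le_ereal_inf_tmp => _ [W FW <-].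
have [x [Vx Wx]] : (V `&` W) !=set0 := filter_ex (filterI FV FW).
apply: (@le_trans _ _ (h x)); first by apply: ereal_inf_lbound; exists x.
by apply: ereal_sup_ubound; exists x.
Qed.

Lemma le_lne (R : realType) (x y : \bar R) : (x <= y)%E -> (lne x <= lne y)%E.
Proof.
case: x y => [x| |] [y| |] //= xy; rewrite ?leey ?leNye //.
(* [lne] takes the value [-oo] at every real that is not positive. *)
rewrite lee_fin in xy; case: ifPn => [|]; rewrite ?leNye// -ltNge => x0.
have y0 := lt_le_trans x0 xy.
by rewrite ifN -?ltNge// lee_fin ler_ln.
Qed.

(** A constant factor in a covering estimate adds a constant [A] to its logarithm; near 0 this is
    less than any fraction [e] of [- ln d]. *)
Lemma near0_ln (R : realType) (A e d0 : R) : 0 < e -> 0 < d0 ->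
  ((0 : R)^'+) [set d : R | [/\ 0 < d, d < d0, 0 < - ln d & A < e * - ln d]].
Proof.
move=> e0 d00; near=> d; have d_gt0 : 0 < d by [].
split=> //.
  by rewrite oppr_gt0 ln_lt0// d_gt0; near: d; exact: nbhs_right_lt.
rewrite mulrN ltrNr mulrC -ltr_pdivlMr// -[ltRHS]expRK ltr_ln ?posrE ?expR_gt0//.
by near: d; apply: nbhs_right_lt; exact: expR_gt0.
Unshelve. all: by end_near. Qed.

Lemma upper_box_dim_le (R : realType) (n : nat) (F : set 'rV[R]_n)
    (c A d0 : R) : 0 < A -> 0 < d0 ->
  (forall d, 0 < d -> d < d0 -> (covering_number F d <= (A * d `^ (- c))%:E)%E) ->
  (upper_box_dim F <= c%:E)%E.
Proof.
move=> A0 d00 hF; apply/lee_addgt0Pr => e e0.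
apply: (limf_esup_le_near (near0_ln (ln A) e0 d00)).
move=> d [d_gt0 dd0 lnd hA]; rewrite /box_ratio.
apply: (@le_trans _ _ ((ln (A * d `^ (- c)))%:E * ((- ln d)^-1)%:E)%E).
  apply: lee_wpmul2r; first by rewrite lee_fin invr_ge0 ltW.
  rewrite -lne_EFin ?mulr_gt0 ?powR_gt0//; apply: le_lne; exact: hF.
rewrite -EFinM -EFinD lee_fin ler_pdivrMr// lnM ?posrE ?powR_gt0// ln_powR.
by lra.
Qed.

Lemma lower_box_dim_ge (R : realType) (n : nat) (F : set 'rV[R]_n)
    (c A d0 : R) : 0 < A -> 0 < d0 ->
  (forall d, 0 < d -> d < d0 -> ((A * d `^ (- c))%:E <= covering_number F d)%E) ->
  (c%:E <= lower_box_dim F)%E.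
Proof.
move=> A0 d00 hF; apply/lee_addgt0Pr => e e0; rewrite -leeBlDr//.
apply: (limf_einf_ge_near (near0_ln (- ln A) e0 d00)).
move=> d [d_gt0 dd0 lnd hA]; rewrite /box_ratio.
apply: (@le_trans _ _ ((ln (A * d `^ (- c)))%:E * ((- ln d)^-1)%:E)%E); last first.
  apply: lee_wpmul2r; first by rewrite lee_fin invr_ge0 ltW.
  rewrite -lne_EFin ?mulr_gt0 ?powR_gt0//; apply: le_lne; exact: hF.
rewrite -EFinM -EFinB lee_fin ler_pdivlMr// lnM ?posrE ?powR_gt0// ln_powR.
by lra.
Qed.

Lemma dyadic_between (R : realType) (E d : R) : 0 < d -> d < E ->
  exists n, E / 2 ^+ n.+1 <= d < E / 2 ^+ n.
Proof.
move=> d0 dE; have E0 : 0 < E := lt_trans d0 dE.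
have ex : exists n, E / 2 ^+ n <= d.
  exists (Num.truncn (E / d)).+1.
  rewrite ler_pdivrMr ?exprn_gt0// mulrC -ler_pdivrMr// ltW//.
  apply: (lt_le_trans (truncnS_gt _)).
  by rewrite -natrX ler_nat ltnW// ltn_expl.
(* The least exponent reaching below [d] is not 0 because [d < E]; minimality at its predecessor
   gives the upper bound. *)
case: (ex_minnP ex) => -[|n] hn min; first by rewrite expr0 divr1 leNgt dE in hn.
exists n; rewrite hn ltNge; apply/negP => /min.
by rewrite ltnn.
Qed.

Lemma le_covering_number (R : realType) (n : nat) (F : set 'rV[R]_n) (d e : R) :
  d <= e -> (covering_number F e <= covering_number F d)%E.
Proof.
move=> de; apply: le_ereal_inf => _ [N [U [FU dU]] <-]; exists N => //.
by exists U; split=> // i; apply: (le_trans (dU i)); rewrite lee_fin.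
Qed.

Lemma upper_box_dim_le_dyadic (R : realType) (n : nat) (F : set 'rV[R]_n)
    (c A E : R) : 0 < A -> 0 < E -> 0 <= c ->
  (forall k, (covering_number F (E / 2 ^+ k) <= (A * (2 ^+ k) `^ c)%:E)%E) ->
  (upper_box_dim F <= c%:E)%E.
Proof.
move=> A0 E0 c0 hF.
(* Covers are taken at the dyadic scale [k.+1] just below [d]; [d < E / 2 ^+ k] gives
   [2 ^+ k.+1 < 2 * E / d], hence the factor [2 * E]. *)
apply: (@upper_box_dim_le _ _ _ _ (A * (2 * E) `^ c) E) => //.
  by rewrite mulr_gt0 ?powR_gt0 ?mulr_gt0.
move=> d d0 dE; have [k /andP[kd dk]] := dyadic_between d0 dE.
apply: (le_trans (le_covering_number _ kd)); apply: (le_trans (hF _)).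
rewrite lee_fin -mulrA ler_pM2l// powRN -powR_inv1; last exact: powR_ge0.
rewrite -powRrM mulrN1 -mulN1r powRrM powR_inv1; last exact: ltW.
rewrite -powRM ?invr_ge0 ?mulr_ge0 ?(ltW E0) ?(ltW d0)//.
rewrite ge0_ler_powR ?nnegrE ?divr_ge0 ?mulr_ge0 ?exprn_ge0 ?(ltW E0) ?(ltW d0)//.
rewrite ler_pdivlMr// exprS -mulrA ler_pM2l//.
by rewrite mulrC -ler_pdivlMr ?exprn_gt0// ltW.
Qed.

Lemma lower_box_dim_ge_dyadic (R : realType) (n : nat) (F : set 'rV[R]_n)
    (c : R) : 0 <= c ->
  (forall k d, d < (2 ^+ k)^-1 -> (((2 ^+ k) `^ c)%:E <= covering_number F d)%E) ->
  (c%:E <= lower_box_dim F)%E.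
Proof.
move=> c0 hF.
(* For [d] between scales [k.+1] and [k], level [k] applies, and [2 ^+ k] is at least
   [(2 * d)^-1]. *)
apply: (@lower_box_dim_ge _ _ _ _ ((2 : R) `^ (- c)) 1) => //.
move=> d d0 d1; have [k] := dyadic_between d0 d1.
rewrite !div1r => /andP[kd dk]; apply: le_trans (hF k d dk).
rewrite -powRM ?(ltW d0)// powRN -powR_inv1 ?powR_ge0// -powRrM mulrN1 -mulN1r.
rewrite powRrM powR_inv1 ?mulr_ge0 ?(ltW d0)// lee_fin.
rewrite ge0_ler_powR ?nnegrE ?invr_ge0 ?exprn_ge0 ?mulr_ge0 ?(ltW d0)//.
rewrite -[leRHS]invrK lef_pV2 ?posrE ?invr_gt0 ?exprn_gt0 ?mulr_gt0//.
by move: kd; rewrite exprS invfM ler_pdivrMl.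
Qed.

(** * The Sierpinski gasket *)

Lemma enorm_ge0 (R : realType) (n : nat) (x : 'rV[R]_n) : 0 <= enorm x.
Proof. exact: sqrtr_ge0. Qed.

Lemma enormZ (R : realType) (n : nat) (c : R) (x : 'rV[R]_n) :
  enorm (c *: x) = `|c| * enorm x.
Proof.
rewrite /enorm -sqrtr_sqr -sqrtrM ?sqr_ge0// mulr_sumr.
by congr Num.sqrt; apply: eq_bigr => i _; rewrite mxE exprMn.
Qed.

Lemma enorm_sq (R : realType) (n : nat) (x : 'rV[R]_n) :
  enorm x ^+ 2 = \sum_(i < n) x 0 i ^+ 2.
Proof. by rewrite sqr_sqrtr// sumr_ge0// => i _; exact: sqr_ge0. Qed.

Lemma enorm_point3B (R : realType) (x y : 'rV[R]_2) (a b : R) :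
  enorm (point3 x a - point3 y b) = Num.sqrt (enorm (x - y) ^+ 2 + (a - b) ^+ 2).
Proof.
rewrite enorm_sq /enorm; congr Num.sqrt.
rewrite [LHS](@big_split_ord _ _ _ 2 1)/= big_ord1; congr (_ + _).
  by apply: eq_bigr => i _; rewrite !mxE !(unsplitK (inl i)).
by rewrite !mxE !(unsplitK (inr ord0)) !mxE eqxx !mulr1n.
Qed.

(** * The functional equation *)

Lemma base_part_point3 (R : realType) (x : 'rV[R]_2) (a : R) :
  base_part (point3 x a) = x.
Proof. exact: row_mxKl. Qed.

Lemma height_point3 (R : realType) (x : 'rV[R]_2) (a : R) :
  height (point3 x a) = a.
Proof.
rewrite /height (_ : ord_max = rshift 2 (ord0 : 'I_1)); last exact/val_inj.
by rewrite mxE (unsplitK (inr ord0)) mxE eqxx.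
Qed.

(** Invariance puts the image of the graph point over [x] back on the graph, above [L i x];
    comparing heights there gives the equation. *)
Lemma fractal_functional_equation (R : realType) (S : set 'rV[R]_2)
    (f b : 'rV[R]_2 -> R) (alpha : 'I_3 -> R) (fa : 'rV[R]_2 -> R) :
  is_alpha_fractal_function S f b alpha fa ->
  forall (i : 'I_3) (x : 'rV[R]_2), S x ->
  fa (L i x) = alpha i * fa x + f (L i x) - alpha i * b x.
Proof.
move=> [_ [_ _ GE]] i x Sx.
have : graph_on S fa (fractal_map f b alpha i (point3 x (fa x))).
  by rewrite GE; exists i => //; exists (point3 x (fa x)) => //; exists x.
rewrite /fractal_map base_part_point3 height_point3 => -[y Sy yE].
have := congr1 (@base_part R) yE; have := congr1 (@height R) yE.
by rewrite !base_part_point3 !height_point3 => + yx; rewrite yx.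
Qed.

(** * Words and lattice coordinates *)

Definition gasket_map (R : realType) (w : seq 'I_3) (x : 'rV[R]_2) :=
  foldr (@L R) x w.

Lemma gasket_map_stable (R : realType) (S : set 'rV[R]_2) :
  is_sierpinski_gasket S -> forall w x, S x -> S (gasket_map w x).
Proof.
move=> [_ _ SE] w x Sx; elim: w => //= i w ih.
by rewrite SE; exists i => //; exists (gasket_map w x).
Qed.

Lemma gasket_map_surj (R : realType) (S : set 'rV[R]_2) (n : nat) :
  is_sierpinski_gasket S -> forall x, S x ->
  exists (w : n.-tuple 'I_3) (z : 'rV[R]_2), S z /\ x = gasket_map w z.
Proof.
move=> [_ _ SE]; elim: n => [|n ih] x Sx; first by exists [tuple], x.
have : (\bigcup_i (L i @` S)) x by rewrite -SE.
move=> [i _ [y Sy <-]]; have [w [z [Sz ->]]] := ih y Sy.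
by exists [tuple of i :: w], z.
Qed.

Lemma L_sub (R : realType) (i : 'I_3) (x y : 'rV[R]_2) :
  L i x - L i y = 2^-1 *: (x - y).
Proof. by rewrite /L opprD addrACA subrr addr0 -scalerBr opprB addrA subrK. Qed.

Lemma L_midE (R : realType) (i : 'I_3) (x : 'rV[R]_2) :
  L i x = 2^-1 *: (x + vertex R i).
Proof.
rewrite /L !scalerDr scalerN -addrA; congr (_ + _).
by rewrite addrC -{1}(scale1r (vertex R i)) -scalerBl; congr (_ *: _); field.
Qed.

Lemma gasket_mapB (R : realType) (w : seq 'I_3) (x y : 'rV[R]_2) :
  gasket_map w x - gasket_map w y = (2 ^+ size w)^-1 *: (x - y).
Proof.
elim: w => [|i w ih]; first by rewrite expr0 invr1 scale1r.
by rewrite /= L_sub ih scalerA exprS invfM.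
Qed.

(* For [j = i2, i3] these are the lattice coordinates of [L_w], scaled by [2^n]:
   the base 2 expansion whose digits mark the occurrences of [j] in [w]. *)
Fixpoint digits (j : 'I_3) (w : seq 'I_3) : nat :=
  if w is i :: w' then ((i == j) * 2 ^ size w' + digits j w')%N else 0%N.

(** As [L i] averages with vertex [i], prefixing [i] halves everything and adds [vertex R i] with
    weight [2 ^ size w] inside the scaled sum. *)
Lemma gasket_map_digits (R : realType) (w : seq 'I_3) (x : 'rV[R]_2) :
  gasket_map w x =
  (2 ^+ size w)^-1 *: (x + \sum_(j < 3) (digits j w)%:R *: vertex R j).
Proof.
elim: w => [|i w ih] /=.
  by rewrite expr0 invr1 scale1r big1 ?addr0// => j _; rewrite scale0r.
rewrite L_midE ih exprS invfM -scalerA; congr (_ *: _).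
under [in RHS]eq_bigr do rewrite natrD scalerDl.
rewrite big_split/= [X in _ *: (x + (X + _))](bigD1 i)//= eqxx mul1n.
rewrite [X in _ *: (x + (_ + X + _))]big1 ?addr0; last first.
  by move=> j /negPf; rewrite eq_sym => ->; rewrite mul0n scale0r.
rewrite addrCA [RHS]scalerDr [RHS]addrC natrX scalerA mulVf ?scale1r ?expf_neq0//.

Qed.

Lemma sum_I3 (V : nmodType) (F : 'I_3 -> V) :
  \sum_(j < 3) F j = F i1 + F i2 + F i3.
Proof.
rewrite !big_ord_recr big_ord0/= add0r.
by congr (F _ + F _ + F _); exact/val_inj.
Qed.

(** Each position of [w] carries the digit 1 for exactly one [j]. Hence two of the three numbers
    determine the third. *)
Lemma sum_digits (w : seq 'I_3) : (\sum_(j < 3) digits j w).+1 = (2 ^ size w)%N.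
Proof.
elim: w => [|i w ih] /=; first by rewrite big1.
rewrite big_split/= (bigD1 i)//= eqxx mul1n big1 => [|j /negPf]; last first.
  by rewrite eq_sym => ->.
by rewrite addn0 -addnS ih expnS mul2n addnn.
Qed.

Lemma digits_lt (j : 'I_3) (w : seq 'I_3) : (digits j w < 2 ^ size w)%N.
Proof. by rewrite -sum_digits ltnS (bigD1 j)//= leq_addr. Qed.

Lemma digits_inj (w v : seq 'I_3) : size w = size v ->
  (forall j, digits j w = digits j v) -> w = v.
Proof.
elim: w v => [|i w ih] [|i' v]//= [sz] dE.
have ii' : i = i'.
  (* If the heads differ, the number for [i] has its leading digit set in one word and is below
     [2 ^ size v] in the other. *)
  apply/eqP/negPn/negP => ii'; have := dE i.
  rewrite /= eqxx eq_sym (negPf ii') mul1n mul0n add0n => e.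
  by have := digits_lt i v; rewrite -e -sz ltnNge leq_addr.
by rewrite -ii' (ih v sz)// => j; have := dE j; rewrite /= ii' sz => /addnI.
Qed.

(* In the basis q_2, q_3 of the triangular lattice, the squared norm of
   (a, b) is the integral form a^2 + a b + b^2. *)
Lemma gasket_map_separated (R : realType) (w v : seq 'I_3) (x : 'rV[R]_2) :
  size w = size v -> w != v ->
  (2 ^+ size w)^-1 <= enorm (gasket_map w x - gasket_map v x).
Proof.
move=> sz wv; rewrite !gasket_map_digits -sz -scalerBr enormZ.
rewrite ger0_norm ?invr_ge0 ?exprn_ge0// ler_peMr ?invr_ge0 ?exprn_ge0//.
rewrite opprD addrACA subrr add0r -sumrB.
under eq_bigr do rewrite -scalerBl.
pose D j : int := (digits j w)%:Z - (digits j v)%:Z.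
have DE j : (digits j w)%:R - (digits j v)%:R = (D j)%:~R :> R.
  by rewrite /D rmorphB.
(* Vertex [i1] is the origin, so only [i2] and [i3] count; if both agreed, [sum_digits] would force
   agreement at [i1] and equal words. *)
have D_neq0 : (D i2 != 0) || (D i3 != 0).
  rewrite -negb_and; apply: contra wv => /andP[/eqP + /eqP].
  move=> /subr0_eq[e2] /subr0_eq[e3]; apply/eqP/digits_inj => // j.
  have := sum_digits w; rewrite sz -sum_digits => -[].
  rewrite !sum_I3 e2 e3 => /addIn/addIn.
  case: j => -[|[|[|//]]] p e1.
  - by rewrite (_ : Ordinal _ = i1); last exact/val_inj.
  - by rewrite (_ : Ordinal _ = i2); last exact/val_inj.
  - by rewrite (_ : Ordinal _ = i3); last exact/val_inj.
(* The form is an integer, so positivity suffices; completing the square shows that four times it is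
   positive. *)
have Q1 : 1 <= D i2 ^+ 2 + D i2 * D i3 + D i3 ^+ 2.
  rewrite -gtz0_ge1 -(pmulr_rgt0 _ (isT : (0 < 4 :> int))).
  have -> : 4 * (D i2 ^+ 2 + D i2 * D i3 + D i3 ^+ 2) =
    (2 * D i2 + D i3) ^+ 2 + 3 * D i3 ^+ 2 by ring.
  have [d3|d3] := eqVneq (D i3) 0.
    rewrite d3 eqxx orbF in D_neq0.
    have -> : (2 * D i2 + D i3) ^+ 2 + 3 * D i3 ^+ 2 = 4 * D i2 ^+ 2.
      by rewrite d3; ring.
    by rewrite mulr_gt0// exprn_even_gt0.
  by rewrite ltr_wpDl ?sqr_ge0// mulr_gt0// exprn_even_gt0.
rewrite -[leLHS]sqrtr1 ler_wsqrtr//.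
rewrite sum_I3 !DE big_ord_recr big_ord1/= !mxE/=.
have s3 : Num.sqrt (3 : R) ^+ 2 = 3 by rewrite sqr_sqrtr.
have : 1 <= (D i2)%:~R ^+ 2 + (D i2)%:~R * (D i3)%:~R + (D i3)%:~R ^+ 2 :> R.
  by rewrite -!rmorphXn -rmorphM -!rmorphD ler1z.
move/le_trans; apply; rewrite le_eqVlt; apply/orP; left; apply/eqP.
by field: s3.
Qed.

(** * Lower bound on covering numbers *)

Lemma gasket_covering_number (R : realType) (S : set 'rV[R]_2)
    (g : 'rV[R]_2 -> R) (k : nat) (d : R) :
  is_sierpinski_gasket S -> d < (2 ^+ k)^-1 ->
  (((3 ^ k)%:R : R)%:E <= covering_number (graph_on S g) d)%E.
Proof.
move=> hS dk; apply: le_ereal_inf_tmp => _ [N [U [GU dU]] <-].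
have [[x0 Sx0] _ _] := hS.
have /choice[c hc] (w : k.-tuple 'I_3) : exists i : 'I_N,
    U i (point3 (gasket_map w x0) (g (gasket_map w x0))).
  have [|i _ ?] := GU (point3 (gasket_map w x0) (g (gasket_map w x0))).
    by exists (gasket_map w x0) => //; exact: gasket_map_stable.
  by exists i.
rewrite lee_fin ler_nat -[X in (X ^ _)%N](card_ord 3) -card_tuple -[leqRHS]card_ord.
(* The choice is injective: two words sharing a set would give graph points within [d], while their
   projections are already [2^-k] apart. *)
apply: (leq_card c) => w v cwv; apply/eqP/negPn/negP => wv.
set p := point3 (gasket_map w x0) (g (gasket_map w x0)).
set q := point3 (gasket_map v x0) (g (gasket_map v x0)).
have : (enorm (p - q) <= d).
  rewrite -lee_fin; apply: le_trans (dU (c w)); apply: ereal_sup_ubound.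
  by exists p => //; exists q => //; rewrite cwv.
apply/negP; rewrite -ltNge; apply: (lt_le_trans dk).
have := @gasket_map_separated R w v x0; rewrite !size_tuple => /(_ erefl wv).
move=> /le_trans; apply; rewrite enorm_point3B.
rewrite -[leLHS]ger0_norm ?enorm_ge0// -sqrtr_sqr ler_wsqrtr//.
by rewrite lerDl sqr_ge0.
Qed.

(** * Boundedness of compact sets *)

Lemma compact_rV_bounded (R : realType) (n : nat) (A : set 'rV[R]_n.+1) :
  compact A -> exists2 M : R, 0 <= M & forall x, A x -> forall i, `|x 0 i| <= M.
Proof.
move=> /compact_bounded[N [_ hN]]; exists (`|N| + 1) => [|x Ax i].
  by rewrite addr_ge0.
have := hN (`|N| + 1); rewrite (le_lt_trans (ler_norm N)) ?ltrDl// => /(_ isT x Ax).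
apply: le_trans; rewrite /Num.norm/= mx_normrE.
exact: (le_bigmax _ (fun ij => `|x ij.1 ij.2|) (0, i)).
Qed.

Lemma compact_enorm_bounded (R : realType) (S : set 'rV[R]_2) :
  compact S -> exists2 D : R, 0 <= D & forall x y, S x -> S y -> enorm (x - y) <= D.
Proof.
(* Both coordinate differences are at most [2 * M], and [8 * M ^+ 2 <= (4 * M) ^+ 2]. *)
move=> /compact_rV_bounded[M M0 hM]; exists (4 * M) => [|x y Sx Sy].
  by rewrite mulr_ge0.
rewrite -[leRHS]ger0_norm ?mulr_ge0// -sqrtr_sqr ler_wsqrtr// big_ord_recr big_ord1/=.
rewrite !mxE; set a := x _ _ - _; set c := x _ _ - _.
have ha : a ^+ 2 <= (2 * M) ^+ 2.
  rewrite -[leLHS]real_normK ?num_real// lerXn2r ?nnegrE ?mulr_ge0//.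
  by rewrite mulr_natl mulr2n (le_trans (ler_normB _ _))// lerD ?hM.
have hc : c ^+ 2 <= (2 * M) ^+ 2.
  rewrite -[leLHS]real_normK ?num_real// lerXn2r ?nnegrE ?mulr_ge0//.
  by rewrite mulr_natl mulr2n (le_trans (ler_normB _ _))// lerD ?hM.
apply: (le_trans (lerD ha hc)); rewrite -subr_ge0.
have -> : (4 * M) ^+ 2 - ((2 * M) ^+ 2 + (2 * M) ^+ 2) = 8 * M ^+ 2 by ring.
by rewrite mulr_ge0// sqr_ge0.
Qed.

Lemma graph_bounded (R : realType) (S : set 'rV[R]_2) (g : 'rV[R]_2 -> R) :
  compact (graph_on S g) ->
  exists2 M : R, 0 <= M & forall x y, S x -> S y -> `|g x - g y| <= M.
Proof.
move=> /compact_rV_bounded[M M0 hM]; exists (2 * M) => [|x y Sx Sy].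
  by rewrite mulr_ge0.
have hg z : S z -> `|g z| <= M.
  move=> Sz; rewrite -(height_point3 z (g z)); apply: hM.
  by exists z.
by rewrite mulr_natl mulr2n (le_trans (ler_normB _ _))// lerD ?hg.
Qed.

(** * Hölder exponents above 1 *)

Lemma L_vertex (R : realType) (i : 'I_3) : L i (vertex R i) = vertex R i.
Proof. by rewrite /L subrr scaler0 add0r. Qed.

Lemma midpointC (R : realType) (i j : 'I_3) : midpoint R i j = midpoint R j i.
Proof. by rewrite /midpoint !L_midE addrC. Qed.

(** The vertex is the fixed point of the contraction [L i], so it is the limit of the iterates of
    any point of the closed set [S]. *)
Lemma vertex_in_gasket (R : realType) (S : set 'rV[R]_2) (i : 'I_3) :
  is_sierpinski_gasket S -> S (vertex R i).
Proof.
move=> hS; have [[x Sx] cS _] := hS.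
have clS : closed S by apply: compact_closed => //; exact: norm_hausdorff.
apply: (@closed_cvg _ _ \oo _ (fun n => gasket_map (nseq n i) x) S clS).
  by apply: nearW => n; exact: gasket_map_stable.
have -> : (fun n => gasket_map (nseq n i) x) =
    (fun n => (2^-1) ^+ n *: (x - vertex R i) + vertex R i).
  apply/funext => n; rewrite -[LHS](subrK (gasket_map (nseq n i) (vertex R i))).
  rewrite gasket_mapB size_nseq exprVn; congr (_ + _).
  by elim: n => //= n ->; exact: L_vertex.
rewrite -{3}[vertex R i]add0r -(scale0r (x - vertex R i)).
apply: cvgD; last exact: cvg_cst.
apply: cvgZr_tmp; apply: cvg_expr.
by rewrite ger0_norm ?invr_ge0// invf_lt1 ?ltr1n.
Qed.

(* The edge from q_i to q_j consists of 2^n translates of its 2^-n copy, so for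
   eta > 1 the increment along it is at most 2^n (2^-n)^eta, up to a constant. *)
Lemma holder_gt1_vertex_increment (R : realType) (S : set 'rV[R]_2) (eta C : R)
    (n : nat) (g : 'rV[R]_2 -> R) (i j : 'I_3) : is_sierpinski_gasket S ->
  (forall x y, S x -> S y -> `|g x - g y| <= C * enorm (x - y) `^ eta) ->
  `|g (vertex R i) - g (vertex R j)| <=
    C * enorm (vertex R i - vertex R j) `^ eta * (2 * 2^-1 `^ eta) ^+ n.
Proof.
move=> hS; have Sv k := vertex_in_gasket k hS.
have SL k x : S x -> S (L k x) by move=> Sx; exact: (gasket_map_stable hS [:: k]).
elim: n C g => [|n ih] C g hg; first by rewrite expr0 mulr1 hg.
have hgL k x y : S x -> S y ->
    `|g (L k x) - g (L k y)| <= C * 2^-1 `^ eta * enorm (x - y) `^ eta.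
  move=> Sx Sy; apply: (le_trans (hg _ _ (SL k x Sx) (SL k y Sy))).
  by rewrite L_sub enormZ ger0_norm ?invr_ge0// powRM ?enorm_ge0// mulrA.
have := ih _ (fun x => g (L i x)) (hgL i); rewrite L_vertex.
have := ih _ (fun x => g (L j x)) (hgL j); rewrite L_vertex.
rewrite -![L _ _]/(midpoint R _ _) (midpointC R j i).
set u := g (vertex R i); set v := g (vertex R j); set m := g (midpoint R i j).
move=> h2 h1; rewrite -(subrKA m); apply: (le_trans (ler_normD _ _)).
apply: (le_trans (lerD h1 h2)); rewrite exprS le_eqVlt; apply/orP; left; apply/eqP.
by ring.
Qed.

Lemma holder_gt1_vertex_eq (R : realType) (S : set 'rV[R]_2) (eta C : R)
    (g : 'rV[R]_2 -> R) (i j : 'I_3) : is_sierpinski_gasket S -> 1 < eta ->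
  (forall x y, S x -> S y -> `|g x - g y| <= C * enorm (x - y) `^ eta) ->
  g (vertex R i) = g (vertex R j).
Proof.
move=> hS eta1 hg; apply/eqP; rewrite -subr_eq0 -normr_le0.
set r := 2 * 2^-1 `^ eta; set K := C * enorm (vertex R i - vertex R j) `^ eta.
have r1 : r < 1.
  rewrite /r -(subrKC 1 eta) powRD; last by rewrite invr_eq0 pnatr_eq0 implybT.
  rewrite powRr1// mulVKf// [ltRHS](_ : 1 = 1 `^ (eta - 1)); last by rewrite powR1.
  by rewrite gt0_ltr_powR ?subr_gt0 ?nnegrE// invf_lt1 ?ltr1n.
have r0 : 0 <= r by rewrite mulr_ge0 ?powR_ge0.
have cvK : geometric K r @ \oo --> 0 by apply: cvg_geometric; rewrite ger0_norm.
apply: (@cvgr_to_ge _ _ _ _ (geometric K r) _ _ cvK).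
by apply: nearW => n; exact: holder_gt1_vertex_increment hS hg.
Qed.

(** For an exponent above 1, [f] agrees at all vertices; the same applied to [f] composed with [L i]
    extends this to the midpoints. *)
Lemma holder_exponent_le1 (R : realType) (S : set 'rV[R]_2) (eta : R)
    (f : 'rV[R]_2 -> R) : is_sierpinski_gasket S -> holder_on S eta f ->
  ~ coplanar (interpolation_points f) -> eta <= 1.
Proof.
move=> hS [C C0 hf] hnc; rewrite leNgt; apply/negP => eta1; apply: hnc.
have fv i j : f (vertex R i) = f (vertex R j) := holder_gt1_vertex_eq i j hS eta1 hf.
have fm i j : f (midpoint R i j) = f (vertex R i).
  rewrite -[in RHS](L_vertex R i).
  apply: (@holder_gt1_vertex_eq R S eta (C * 2^-1 `^ eta) (fun x => f (L i x)) j i) => //.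
  have SL x : S x -> S (L i x) by move=> Sx; exact: (gasket_map_stable hS [:: i]).
  move=> x y Sx Sy; apply: (le_trans (hf _ _ (SL x Sx) (SL y Sy))).
  by rewrite L_sub enormZ ger0_norm ?invr_ge0// powRM ?enorm_ge0// mulrA.
(* The six points lie in a horizontal plane. *)
exists (delta_mx 0 ord_max), (f (vertex R i1)); split.
  by apply/eqP => /matrixP/(_ 0 ord_max); rewrite !mxE !eqxx => /eqP; rewrite oner_eq0.
move=> _ [x hx <-]; rewrite (bigD1 ord_max)//= mxE !eqxx mul1r big1 ?addr0.
  rewrite -/(height (point3 x (f x))) height_point3.
  move: hx; rewrite /= !inE => /or4P[| | |/or3P[]] /eqP ->; rewrite ?fm; exact: fv.
by move=> k /negPf kE; rewrite mxE kE andbF mul0r.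
Qed.

(** * Oscillation and covers of the graph *)

Lemma covering_number_le_card (R : realType) (n : nat) (F : set 'rV[R]_n) (d : R)
    (I : finType) (U : I -> set 'rV[R]_n) :
  F `<=` \bigcup_i U i -> (forall i, (diam (U i) <= d%:E)%E) ->
  (covering_number F d <= (#|I|%:R : R)%:E)%E.
Proof.
move=> FU dU; apply: ereal_inf_lbound; exists #|I| => //.
exists (fun i => U (enum_val i)); split=> // x /FU[i _ Ux].
by exists (enum_rank i) => //; rewrite enum_rankK.
Qed.

Lemma sum_tupleS (V : nmodType) (T : finType) (n : nat) (F : seq T -> V) :
  \sum_(w : n.+1.-tuple T) F w = \sum_i \sum_(w : n.-tuple T) F (i :: w).
Proof.
rewrite pair_big/= (reindex (fun p : T * n.-tuple T => [tuple of p.1 :: p.2])) //=.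
exists (fun w => (thead w, [tuple of behead w])) => [[i w] _|w _] /=.
  by congr (_, _); exact/val_inj.
by rewrite -tuple_eta.
Qed.

(** The oscillation recursion taken with equality: [M] bounds the oscillation over all of [S], and
    the term in [K] bounds the contribution of [f] and [b]. *)
Fixpoint osc_bound (R : realType) (alpha : 'I_3 -> R) (M K r : R)
    (w : seq 'I_3) : R :=
  if w is i :: w' then `|alpha i| * osc_bound alpha M K r w' + K * r ^+ size w'
  else M.

Lemma osc_bound_ge0 (R : realType) (alpha : 'I_3 -> R) (M K r : R)
    (w : seq 'I_3) :
  0 <= M -> 0 <= K -> 0 <= r -> 0 <= osc_bound alpha M K r w.
Proof.
by move=> M0 K0 r0; elim: w => //= i w ih; rewrite addr_ge0 ?mulr_ge0 ?exprn_ge0.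
Qed.

Lemma sum_osc_bound (R : realType) (alpha : 'I_3 -> R) (M K r s : R) (n : nat) :
  0 <= M -> 0 <= K -> 0 <= r -> 3 * r <= s -> \sum_(i < 3) `|alpha i| < s ->
  \sum_(w : n.-tuple 'I_3) osc_bound alpha M K r w <=
    (M + 3 * K / (s - \sum_(i < 3) `|alpha i|)) * s ^+ n.
Proof.
set psi := \sum_(i < 3) `|alpha i| => M0 K0 r0 rs psis.
have psi0 : 0 <= psi by rewrite sumr_ge0.
have d0 : 0 < s - psi by rewrite subr_gt0.
(* [A] is chosen so that [M <= A] starts the induction and [psi * A + 3 * K <= s * A] carries it
   on. *)
set A := M + _.
elim: n => [|n ih].
  rewrite (eq_bigr (fun=> M)) => [|w _]; last by rewrite tuple0.
  by rewrite sumr_const card_tuple expr0 mulr1 mulr1n lerDl divr_ge0 ?mulr_ge0// ltW.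
rewrite (sum_tupleS n (osc_bound alpha M K r))/=.
under eq_bigr do rewrite big_split/= -mulr_sumr.
rewrite big_split/= -mulr_suml -/psi.
under [X in _ + X]eq_bigr do under eq_bigr do rewrite size_tuple.
rewrite !sumr_const card_ord card_tuple card_ord.
have -> : K * r ^+ n *+ 3 ^ n *+ 3 = 3 * K * (3 * r) ^+ n.
  by rewrite exprMn -[LHS]mulr_natl -[K * _ *+ _]mulr_natl natrX; ring.
have h : (3 * r) ^+ n <= s ^+ n by rewrite lerXn2r ?nnegrE ?(le_trans _ rs) ?mulr_ge0.
apply: (@le_trans _ _ (psi * (A * s ^+ n) + 3 * K * s ^+ n)).
  by rewrite lerD ?ler_wpM2l ?mulr_ge0.
rewrite mulrA -mulrDl exprS mulrA ler_wpM2r ?exprn_ge0 ?(le_trans psi0 (ltW psis))//.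
rewrite addrC -lerBrDr [psi * A]mulrC -mulrBr -ler_pdivrMr//.
by rewrite lerDr.
Qed.

(** The exponent is lowered from [e] to [eta] only on the contraction factor, which is at most 1;
    the diameter of [S] keeps [e] and enters [K]. *)
Lemma holder_gasket_map (R : realType) (S : set 'rV[R]_2) (eta e : R)
    (g : 'rV[R]_2 -> R) :
  is_sierpinski_gasket S -> holder_on S e g -> 0 <= e -> eta <= e ->
  exists2 K : R, 0 <= K & forall w x y, S x -> S y ->
    `|g (gasket_map w x) - g (gasket_map w y)| <= K * (2 `^ (- eta)) ^+ size w.
Proof.
move=> hS [C C0 hg] e0 etae; have [_ cS _] := hS.
have [D D0 hD] := compact_enorm_bounded cS.
exists (C * D `^ e) => [|w x y Sx Sy]; first by rewrite mulr_ge0// powR_ge0.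
apply: (le_trans (hg _ _ _ _)); [exact: gasket_map_stable..|].
rewrite -mulrA ler_wpM2l// gasket_mapB enormZ ger0_norm ?invr_ge0 ?exprn_ge0//.
rewrite powRM ?enorm_ge0 ?invr_ge0 ?exprn_ge0// mulrC.
apply: ler_pM; rewrite ?powR_ge0//.
  by rewrite ge0_ler_powR ?nnegrE ?enorm_ge0// hD.
have -> : (2 `^ (- eta)) ^+ size w = ((2 : R) ^- size w) `^ eta.
  rewrite -powR_mulrn ?powR_ge0// -powRrM mulrC mulrN -mulNr.
  by rewrite powRrM powRN powR_mulrn.
apply: ger_powR => //; rewrite invr_gt0 exprn_gt0//=.
by rewrite invf_le1 ?exprn_gt0// exprn_ege1// ler1n.
Qed.

Lemma fractal_oscillation (R : realType) (S : set 'rV[R]_2) (f b : 'rV[R]_2 -> R)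
    (eta eta1 eta2 : R) (alpha : 'I_3 -> R) (fa : 'rV[R]_2 -> R) :
  is_sierpinski_gasket S -> 0 <= eta -> eta <= eta1 -> eta <= eta2 ->
  holder_on S eta1 f -> holder_on S eta2 b -> (forall i, `|alpha i| <= 1) ->
  is_alpha_fractal_function S f b alpha fa ->
  exists M K, [/\ 0 <= M, 0 <= K & forall w x y, S x -> S y ->
    `|fa (gasket_map w x) - fa (gasket_map w y)| <=
      osc_bound alpha M K (2 `^ (- eta)) w].
Proof.
move=> hS eta0 le1 le2 hf hb halpha hfa; have [_ [_ cG _]] := hfa.
have [M M0 hM] := graph_bounded cG.
have [Kf Kf0 hKf] := holder_gasket_map hS hf (le_trans eta0 le1) le1.
have [Kb Kb0 hKb] := holder_gasket_map hS hb (le_trans eta0 le2) le2.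
set r := 2 `^ (- eta).
have r0 : 0 <= r by rewrite powR_ge0.
have r1 : r <= 1.
  by rewrite -[leRHS](powRr0 2) ler_powR ?ler1n// oppr_le0.
exists M, (Kf + Kb); split; rewrite ?addr_ge0// => w x y Sx Sy.
elim: w => [|i w ih]; first exact: hM.
rewrite /= !(fractal_functional_equation hfa); try exact: gasket_map_stable.
have hfi := hKf (i :: w) x y Sx Sy; have hbi := hKb w x y Sx Sy.
rewrite /= exprS in hfi.
set u := gasket_map w x in ih hfi hbi *; set v := gasket_map w y in ih hfi hbi *.
have -> : alpha i * fa u + f (L i u) - alpha i * b u -
    (alpha i * fa v + f (L i v) - alpha i * b v) =
    alpha i * (fa u - fa v) + ((f (L i u) - f (L i v)) - alpha i * (b u - b v)).
  by ring.
apply: (le_trans (ler_normD _ _)); rewrite normrM lerD ?ler_wpM2l//.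
apply: (le_trans (ler_normB _ _)); rewrite mulrDl lerD//.
  (* The cell of [f] is one level deeper than that of [b]; the extra factor [r <= 1] is dropped. *)
  apply: (le_trans hfi); rewrite ler_wpM2l// -[leRHS]mul1r ler_wpM2r//.
by apply: le_trans hbi; rewrite normrM -[leRHS]mul1r ler_wpM2r.
Qed.

Lemma diam_slab (R : realType) (B : set 'rV[R]_2) (J : set R) (p q : R) :
  0 <= p -> 0 <= q ->
  (forall x y, B x -> B y -> enorm (x - y) <= p) ->
  (forall a c, J a -> J c -> `|a - c| <= q) ->
  (diam [set point3 x a | x in B & a in J] <= (p + q)%:E)%E.
Proof.
move=> p0 q0 hB hJ; apply: ge_ereal_sup => _ [_ [x Bx [a Ja <-]] [_ [y By [c Jc <-]] <-]].
rewrite lee_fin enorm_point3B.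
rewrite -[leRHS]ger0_norm ?addr_ge0// -sqrtr_sqr ler_wsqrtr// [leRHS]sqrrD [leRHS]addrAC.
have h1 : enorm (x - y) ^+ 2 <= p ^+ 2 by rewrite lerXn2r ?nnegrE ?enorm_ge0 ?hB.
have h2 : (a - c) ^+ 2 <= q ^+ 2.
  by rewrite -[leLHS]real_normK ?num_real// lerXn2r ?nnegrE ?hJ.
by apply: (le_trans (lerD h1 h2)); rewrite lerDl mulrn_wge0 ?mulr_ge0.
Qed.

(* Over each cell [gasket_map w S] the graph lies in a box of height
   [2 * o w], cut here into slabs of height [2^-n]. *)
Lemma graph_covering_number (R : realType) (S : set 'rV[R]_2)
    (g : 'rV[R]_2 -> R) (o : seq 'I_3 -> R) (D : R) (n : nat) :
  is_sierpinski_gasket S -> 0 <= D ->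
  (forall x y, S x -> S y -> enorm (x - y) <= D) ->
  (forall w, 0 <= o w) ->
  (forall w x y, S x -> S y ->
    `|g (gasket_map w x) - g (gasket_map w y)| <= o w) ->
  (covering_number (graph_on S g) ((D + 1) / 2 ^+ n) <=
   (2 * 2 ^+ n * \sum_(w : n.-tuple 'I_3) o w + 3 ^+ n)%:E)%E.
Proof.
move=> hS D0 hD o0 ho; have [[x0 Sx0] _ _] := hS.
(* Heights above the bottom [m w] of the box range over [[0, 2 * o w]]; the successor accounts for
   the last, partial slab. *)
pose N (w : n.-tuple 'I_3) := (Num.truncn (2 * 2 ^+ n * o w)).+1.
pose m (w : n.-tuple 'I_3) := g (gasket_map w x0) - o w.
(* Dependent pairs, since the number of slabs varies with the cell. *)
pose U (p : {w : n.-tuple 'I_3 & 'I_(N w)}) : set 'rV[R]_3 :=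
  [set point3 x a | x in gasket_map (tag p) @` S &
    a in [set a | (tagged p : nat)%:R <= (a - m (tag p)) * 2 ^+ n <=
                    (tagged p).+1%:R]].
have p2 : 0 < (2 : R) ^+ n by rewrite exprn_gt0.
apply: (@le_trans _ _ (#|{: {w : n.-tuple 'I_3 & 'I_(N w)}}|%:R : R)%:E).
  apply: (@covering_number_le_card _ _ _ _ _ U).
    move=> _ [x Sx <-]; have [w [z [Sz xE]]] := gasket_map_surj n hS Sx.
    have := ho w z x0 Sz Sx0; rewrite ler_norml -xE => /andP[h1 h2].
    have t0 : 0 <= (g x - m w) * 2 ^+ n.
      by rewrite mulr_ge0 ?(ltW p2)// /m; lra.
    have jN : (Num.truncn ((g x - m w) * 2 ^+ n) < N w)%N.
      rewrite ltnS le_truncn// mulrAC ler_wpM2r ?(ltW p2)// /m; lra.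
    exists (Tagged (fun w => 'I_(N w)) (Ordinal jN)) => //.
    exists x; first by exists z.
    exists (g x) => //=.
    by have /andP[-> /ltW] := truncn_itv t0.
  move=> [w j]; rewrite /U /= mulrDl mul1r; apply: diam_slab.
  - by rewrite divr_ge0// ltW.
  - by rewrite invr_ge0 ltW.
  - move=> _ _ [x Sx <-] [y Sy <-]; rewrite gasket_mapB size_tuple enormZ.
    by rewrite ger0_norm ?invr_ge0 ?(ltW p2)// mulrC ler_wpM2r ?invr_ge0 ?(ltW p2)// hD.
  - move=> a c /=; rewrite -natr1 => /andP[a1 a2] /andP[c1 c2].
    rewrite -[leRHS]mul1r ler_pdivlMr// -[X in _ * X]gtr0_norm// -normrM.
    by rewrite ler_norml mulrBl; apply/andP; split; lra.
rewrite lee_fin card_tagged sumnE big_map big_enum/= natr_sum mulr_sumr.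
have -> : (3 : R) ^+ n = \sum_(w : n.-tuple 'I_3) 1.
  by rewrite sumr_const card_tuple card_ord natrX.
(* Each [N w] is at most [2 * 2 ^+ n * o w + 1]; the ones add up to [3 ^+ n]. *)
rewrite -big_split/=; apply: ler_sum => w _; rewrite card_ord [leLHS]mulrSr lerD2r.
by rewrite truncn_le// !mulr_ge0.
Qed.

Lemma fractal_graph_upper_box_dim (R : realType) (S : set 'rV[R]_2)
    (f b : 'rV[R]_2 -> R) (eta eta1 eta2 s : R) (alpha : 'I_3 -> R)
    (fa : 'rV[R]_2 -> R) :
  is_sierpinski_gasket S -> 0 <= eta -> eta <= eta1 -> eta <= eta2 ->
  holder_on S eta1 f -> holder_on S eta2 b -> (forall i, `|alpha i| <= 1) ->
  is_alpha_fractal_function S f b alpha fa ->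
  3 / 2 <= s -> 3 * 2 `^ (- eta) <= s -> \sum_(i < 3) `|alpha i| <= s ->
  (upper_box_dim (graph_on S fa) <= (1 + ln s / ln 2)%:E)%E.
Proof.
move=> hS eta0 le1 le2 hf hb halpha hfa s32 rs psis.
have [M [K [M0 K0 hosc]]] := fractal_oscillation hS eta0 le1 le2 hf hb halpha hfa.
have [_ cS _] := hS; have [D D0 hD] := compact_enorm_bounded cS.
have s0 : 0 < s by apply: lt_le_trans s32; rewrite divr_gt0.
have ln2 : 0 < ln (2 : R) by rewrite ln_gt0// ltr1n.
apply/lee_addgt0Pr => e e0; rewrite -EFinD.
set c := 1 + _ + _; pose s' := s * 2 `^ e.
have ss' : s < s'.
  rewrite /s' ltr_pMr// -[ltLHS]expR0 -[ltRHS](lnK) ?posrE ?powR_gt0// ltr_expR.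
  by rewrite ln_powR mulr_gt0.
have c0 : 0 <= c.
  rewrite /c !addr_ge0 ?(ltW e0)// divr_ge0 ?ln_ge0 ?ler1n//.
  by apply: le_trans s32; rewrite ler_pdivlMr// mul1r ler_nat.
(* By the choice of [c], [2]^ c[is]2 * s * 2 [^ e]. *)
have s'c n : (2 * s') ^+ n = ((2 : R) ^+ n) `^ c.
  rewrite -[2 ^+ n]powR_mulrn// -powRrM [_ * c]mulrC powRrM powR_mulrn ?powR_ge0//.
  congr (_ ^+ n); rewrite /c powRD ?pnatr_eq0 ?implybT// powRD ?pnatr_eq0 ?implybT//.
  rewrite powRr1// -mulrA; congr (_ * (_ * _)).
  by rewrite /powR pnatr_eq0/= divfK ?gt_eqF// lnK.
pose A := M + 3 * K / (s' - \sum_(i < 3) `|alpha i|).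
have A0 : 0 <= A.
  rewrite addr_ge0// divr_ge0 ?mulr_ge0// subr_ge0.
  by rewrite (le_trans psis)// ltW.
apply: (@upper_box_dim_le_dyadic _ _ _ _ (2 * A + 1) (D + 1)) => //.
- by rewrite ltr_wpDl ?mulr_ge0.
- by rewrite ltr_wpDl.
move=> n; have r0 : 0 <= 2 `^ (- eta) by exact: powR_ge0.
apply: (le_trans (graph_covering_number n hS D0 hD _ hosc)).
  by move=> w; exact: osc_bound_ge0.
rewrite lee_fin -s'c [leRHS]mulrDl mul1r exprMn; apply: lerD.
  rewrite mulrACA ler_wpM2l ?mulr_ge0 ?exprn_ge0//.
  apply: sum_osc_bound => //; first exact: le_trans rs (ltW ss').
  exact: le_lt_trans psis ss'.
(* The cell count is absorbed because [3 <= 2 * s]. *)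
rewrite -exprMn lerXn2r ?nnegrE// ?mulr_ge0 ?(ltW s0)//.
by rewrite mulrC -ler_pdivrMr// (le_trans s32)// ltW.
Qed.

(** * The dimension bounds *)

Unset Implicit Arguments.
Set Strict Implicit.

Theorem theorem4p1 (R : realType) (S : set 'rV[R]_2)
    (hS : is_sierpinski_gasket S)
    (f b : 'rV[R]_2 -> R) (eta1 eta2 : R)
    (heta1 : 0 < eta1) (heta2 : 0 < eta2)
    (hf : holder_on S eta1 f) (hb : holder_on S eta2 b)
    (hbf : forall i : 'I_3, b (vertex R i) = f (vertex R i))
    (hnc : ~ coplanar (interpolation_points f))
    (alpha : 'I_3 -> R) (halpha : forall i : 'I_3, -1 < alpha i < 1)
    (fa : 'rV[R]_2 -> R) (hfa : is_alpha_fractal_function S f b alpha fa) :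
  let G := graph_on S fa in
  let psi := \sum_(i < 3) `|alpha i| in
  let eta := Num.min eta1 eta2 in
  (psi * 2 `^ eta / 3 <= 1 ->
    [/\ ((ln 3 / ln 2)%:E <= lower_box_dim G)%E,
        (lower_box_dim G <= upper_box_dim G)%E &
        (upper_box_dim G <= (1 - eta + ln 3 / ln 2)%:E)%E]) /\
  (1 < psi * 2 `^ eta / 3 ->
    [/\ ((ln 3 / ln 2)%:E <= lower_box_dim G)%E,
        (lower_box_dim G <= upper_box_dim G)%E &
        (upper_box_dim G <= (1 + ln psi / ln 2)%:E)%E]).
Proof.
move=> G psi eta.
have ln2 : 0 < ln (2 : R) by rewrite ln_gt0// ltr1n.
have lower : ((ln 3 / ln 2)%:E <= lower_box_dim G)%E.
  apply: lower_box_dim_ge_dyadic => [|k d dk].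
    by rewrite divr_ge0 ?ln_ge0 ?ler1n.
  have -> : (2 ^+ k : R) `^ (ln 3 / ln 2) = (3 ^ k)%:R.
    rewrite -powR_mulrn// -powRrM mulrC powRrM natrX -powR_mulrn//.
    by rewrite [2 `^ _]/powR pnatr_eq0/= divfK ?gt_eqF// lnK ?posrE.
  exact: gasket_covering_number.
have le_lu : (lower_box_dim G <= upper_box_dim G)%E by exact: limf_einf_le_esup.
have eta0 : 0 < eta by rewrite lt_min heta1.
have le1 : eta <= eta1 by rewrite ge_min lexx.
have le2 : eta <= eta2 by rewrite ge_min lexx orbT.
have eta_le1 : eta <= 1 := le_trans le1 (holder_exponent_le1 hS hf hnc).
have halpha1 i : `|alpha i| <= 1.
  by rewrite ler_norml; have /andP[/ltW -> /ltW ->] := halpha i.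
have upper s := @fractal_graph_upper_box_dim R S f b eta eta1 eta2 s alpha fa
  hS (ltW eta0) le1 le2 hf hb halpha1 hfa.
(* This is where [eta <= 1], and so non-coplanarity, enters. *)
have t32 : 3 / 2 <= 3 * (2 : R) `^ (- eta).
  by rewrite ler_wpM2l// -[leLHS]powR_inv1// ler_powR ?ler1n// lerN2.
have psiE : psi * 2 `^ eta / 3 = psi / (3 * 2 `^ (- eta)).
  by rewrite powRN invfM invrK mulrA mulrAC.
have t0 : 0 < 3 * (2 : R) `^ (- eta) by rewrite mulr_gt0// powR_gt0.
rewrite psiE; split.
- rewrite ler_pdivrMr// mul1r => psit; split=> //.
  have -> : 1 - eta + ln 3 / ln 2 = 1 + ln (3 * (2 : R) `^ (- eta)) / ln 2.
    rewrite lnM ?posrE ?powR_gt0// ln_powR mulrDl mulfK ?gt_eqF//.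
    by rewrite addrA addrAC.
  exact: upper.
- rewrite ltr_pdivlMr// mul1r => /ltW tpsi; split=> //.
  by apply: upper => //; exact: le_trans t32 tpsi.
Qed.
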